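(* The functor $\hat F$ on the category of positively convex algebras is proper. In fact, for any two $\hat F$-coalgebras with free finitely generated carrier and any two elements having the same trace, a zig-zag with free and finitely generated nodes relating those elements can be found which has three intermediate nodes, the middle one forming a span (having outgoing arrows).
   Context: $A$ is a fixed finite alphabet. Positively convex algebras are the Eilenberg–Moore algebras of the monad $T$ of finitely supported subprobability distributions on Sets (unit $\eta_X(x)=\delta_x$); the free one on $n$ generators is $\Delta^n=\{\xi\in\mathbb R^n\mid\xi_j\ge0,\sum_j\xi_j\le1\}$. The functor $\hat F$: $\hat F X=\{(o,\phi)\in[0,1]\times X^A\mid \exists\,n_a\in\mathbb N,\ p_{a,j}\in[0,1],\ x_{a,j}\in X:\ o+\sum_a\sum_{j=1}^{n_a}p_{a,j}\le1,\ \phi(a)=\sum_{j=1}^{n_a}p_{a,j}x_{a,j}\}$, $\hat F f=\mathrm{id}_{[0,1]}\times(f\circ-)$. For a coalgebra $c$ write $c(x)=(c_o(x),(c_a(x))_a)$, $c_\varepsilon=\mathrm{id}$, $c_{wa}=c_a\circ c_w$; the trace is $\mathrm{tr}_c(x)=(c_o(c_w(x)))_{w\in A^*}$. Elements $x,y$ of coalgebras $(X,c),(Y,d)$ are behaviourally equivalent if there are coalgebra morphisms $f,g$ into a common coalgebra with $f(x)=g(y)$. A zig-zag relating $x$ and $y$ is a diagram of coalgebra morphisms $(X,c)\xrightarrow{f_1}(Z_1,e_1)\xleftarrow{f_2}(Z_2,e_2)\xrightarrow{f_3}\cdots\xleftarrow{f_{2n}}(Y,d)$ with elements $z_{2k}\in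 Z_{2k}$ ($z_0=x$, $z_{2n}=y$) such that $f_{2k}(z_{2k})=f_{2k-1}(z_{2k-2})$. A functor $F$ on the Eilenberg–Moore category of a finitary monad $T$ is proper if for all $F$-coalgebras $(TB_1,c_1),(TB_2,c_2)$ with $B_j$ finite and $b_j\in B_j$ with $\eta_{B_1}(b_1)$, $\eta_{B_2}(b_2)$ behaviourally equivalent, there is a zig-zag relating them all of whose nodes have free finitely generated carrier. *)

(* Defs.v *)
From HB Require Import structures.
From mathcomp Require Import all_boot all_order all_algebra finmap.
From mathcomp Require Import boolp classical_sets functions cardinality fsbigop.
From mathcomp Require Import reals.
Set Implicit Arguments.
Unset Strict Implicit.
Unset Printing Implicit Defensive.
Import Order.TTheory GRing.Theory Num.Theory.
Local Open Scope ring_scope.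

Section Subdistributions.
Variable R : realType.

(* The sum of a function on an arbitrary type; meaningful when the support is
   finite, and 0 by convention otherwise. [{classic X}] is [X] with its
   classical decidable equality, which [\sum_(_ \in _)] needs. *)
Definition fsumT (X : Type) (g : X -> R) : R :=
  \sum_(x \in [set: {classic X}]) g x.

Record subdist (X : Type) := Subdist {
  sdval :> X -> R ;
  sd_ge0 : forall x, 0 <= sdval x ;
  sd_fin : finite_set [set x | sdval x <> 0]%classic ;
  sd_le1 : fsumT sdval <= 1 }.

Lemma sd_ext X (p q : subdist X) : (forall x, p x = q x) -> p = q.
Proof.
case: p q => [p p0 pf p1] [q q0 qf q1] /= /funext pq; subst q.
by congr Subdist; apply: Prop_irrelevance.
Qed.

Lemma fsumTE X (s : seq {classic X}) (g : X -> R) :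
  uniq s -> (forall x : {classic X}, x \notin s -> g x = 0) ->
  fsumT g = \sum_(x <- s) g x.
Proof.
move=> us gs; rewrite /fsumT (fsbigE s) //.
  by rewrite big_mkcond; apply: eq_bigr => x _; rewrite in_setT.
by move=> x _; exact: gs.
Qed.

Lemma finite_supp X (g : X -> R) : finite_set [set x | g x <> 0]%classic ->
  exists2 s : seq {classic X}, uniq s &
    forall x : {classic X}, x \notin s -> g x = 0.
Proof.
move=> gf; have [S SE] := (@finite_fsetP {classic X} _).1 gf.
exists (enum_fset S); first exact: fset_uniq.
move=> x xS; apply: contrapT => gx.
suff : [set` S]%classic x by rewrite /= (negPf xS).
by rewrite -SE.
Qed.

Lemma finite_suppI X (s : seq {classic X}) (g : X -> R) :
  (forall x : {classic X}, x \notin s -> g x = 0) ->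
  finite_set [set x | g x <> 0]%classic.
Proof.
move=> gs; apply: (@sub_finite_set {classic X} _ [set` s]%classic).
  by move=> x /= gx; apply: contra_notT gx => /gs.
exact: finite_seq.
Qed.

Lemma sd_supp X (p : subdist X) : exists2 s : seq {classic X}, uniq s &
  forall x : {classic X}, x \notin s -> p x = 0.
Proof. exact/finite_supp/sd_fin. Qed.

Section Dirac.
Variables (X : Type) (x : X).

Let delta (y : X) : R := if `[< y = x >] then 1 else 0.

Let delta_supp (y : {classic X}) : y \notin [:: x : {classic X}] -> delta y = 0.
Proof.
rewrite inE /delta => yx; case: asboolP => // e.
by rewrite e eqxx in yx.
Qed.

Let delta_ge0 y : 0 <= delta y.
Proof. by rewrite /delta; case: ifP. Qed.

Let delta_fin : finite_set [set y | delta y <> 0]%classic.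
Proof. exact: finite_suppI delta_supp. Qed.

Let delta_le1 : fsumT delta <= 1.
Proof.
rewrite (@fsumTE _ [:: x : {classic X}]) // big_seq1 /delta.
by case: ifP.
Qed.

Definition sdunit : subdist X := Subdist delta_ge0 delta_fin delta_le1.

End Dirac.

Section Bind.
Variables (X Y : Type) (p : subdist X) (k : X -> subdist Y).

Let bind (y : Y) : R := fsumT (fun x => p x * k x y).

Let bindE s y : uniq s -> (forall x : {classic X}, x \notin s -> p x = 0) ->
  bind y = \sum_(x <- s) p x * k x y.
Proof.
move=> us ps; rewrite /bind (fsumTE us) // => x /ps ->.
by rewrite mul0r.
Qed.

Let bind_supp (s : seq {classic X}) : exists2 r : seq {classic Y}, uniq r &
  forall y : {classic Y}, y \notin r -> forall x, x \in s -> k x y = 0.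
Proof.
elim: s => [|x s [r ur rs]]; first by exists [::].
have [t ut kt] := sd_supp (k x).
exists (undup (t ++ r)); first exact: undup_uniq.
move=> y; rewrite mem_undup mem_cat negb_or => /andP[yt yr] z.
rewrite inE => /orP[/eqP->|]; [exact: kt | exact: rs].
Qed.

Let bind_ge0 y : 0 <= bind y.
Proof. by apply: fsumr_ge0 => x _; rewrite mulr_ge0 ?sd_ge0. Qed.

Let bind_fin : finite_set [set y | bind y <> 0]%classic.
Proof.
have [s us ps] := sd_supp p; have [r ur kr] := bind_supp s.
apply: (@finite_suppI _ r) => y /kr ky; rewrite (bindE _ us ps).
by rewrite big1_seq // => x /= /ky ->; rewrite mulr0.
Qed.

Lemma fsumT_bind (g : Y -> R) : fsumT (fun y => bind y * g y) =
  fsumT (fun x => p x * fsumT (fun y => k x y * g y)).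
Proof.
have [s us ps] := sd_supp p; have [r ur kr] := bind_supp s.
rewrite (fsumTE (s := r)) //; last first.
  move=> y /kr ky; rewrite (bindE _ us ps) big1_seq ?mul0r // => x /= /ky ->.
  by rewrite mulr0.
rewrite (fsumTE us); last by move=> x /ps ->; rewrite mul0r.
under eq_bigr do rewrite (bindE _ us ps) mulr_suml.
rewrite exchange_big /=; apply: eq_big_seq => x xs.
rewrite (fsumTE (s := r)) //; last by move=> y /kr -> //; rewrite mul0r.
by rewrite mulr_sumr; apply: eq_bigr => y _; rewrite mulrA.
Qed.

Let bind_le1 : fsumT bind <= 1.
Proof.
have -> : bind = (fun y => bind y * 1) by apply: funext => y; rewrite mulr1.
rewrite fsumT_bind; have [s us ps] := sd_supp p.
rewrite (fsumTE us); last by move=> x /ps ->; rewrite mul0r.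
apply: (@le_trans _ _ (fsumT p)); last exact: sd_le1.
rewrite (fsumTE us ps); apply: ler_sum => x _; rewrite ler_piMr ?sd_ge0 //.
have -> : (fun y => k x y * 1) = k x by apply: funext => y; rewrite mulr1.
exact: sd_le1.
Qed.

Definition sdbind : subdist Y := Subdist bind_ge0 bind_fin bind_le1.

End Bind.

Definition sdmap X Y (f : X -> Y) (p : subdist X) : subdist Y :=
  sdbind p (fun x => sdunit (f x)).

Definition sdmul X (P : subdist (subdist X)) : subdist X := sdbind P id.

Definition expect X (p : subdist X) (g : X -> R) : R :=
  fsumT (fun x => p x * g x).

Lemma expect_bind X Y (p : subdist X) (k : X -> subdist Y) g :
  expect (sdbind p k) g = expect p (fun x => expect (k x) g).
Proof. exact: fsumT_bind. Qed.

Lemma expect_unit X (x : X) g : expect (sdunit x) g = g x.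
Proof.
rewrite /expect (@fsumTE _ [:: x : {classic X}]) //=.
  by rewrite big_seq1; case: asboolP => // _; rewrite mul1r.
move=> y; rewrite inE => yx; case: asboolP => [e|_]; last by rewrite mul0r.
by rewrite e eqxx in yx.
Qed.

Lemma expect_map X Y (f : X -> Y) p g : expect (sdmap f p) g = expect p (g \o f).
Proof.
rewrite expect_bind; congr expect; apply: funext => x.
exact: expect_unit.
Qed.

Lemma expect_mul X (P : subdist (subdist X)) g :
  expect (sdmul P) g = expect P (fun p => expect p g).
Proof. exact: expect_bind. Qed.

Lemma expect_ext X (p q : subdist X) :
  (forall g, expect p g = expect q g) -> p = q.
Proof.
have val (r : subdist X) x : expect r (sdunit x) = r x.
  rewrite /expect (@fsumTE _ [:: x : {classic X}]) //=.
    by rewrite big_seq1; case: asboolP => // _; rewrite mulr1.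
  move=> y; rewrite inE => yx; case: asboolP => [e|_]; last by rewrite mulr0.
  by rewrite e eqxx in yx.
by move=> pq; apply: sd_ext => x; rewrite -!val.
Qed.

Lemma expect1 X (p : subdist X) : expect p (fun=> 1) = fsumT p.
Proof. by congr fsumT; apply: funext => x; rewrite mulr1. Qed.

Lemma le_expect X (p : subdist X) f g :
  (forall x, f x <= g x) -> expect p f <= expect p g.
Proof.
move=> fg; have [s us ps] := sd_supp p; rewrite /expect.
rewrite !(fsumTE us); try by move=> x /ps ->; rewrite mul0r.
by apply: ler_sum => x _; rewrite ler_wpM2l ?sd_ge0.
Qed.

Lemma expectD X (p : subdist X) f g :
  expect p (fun x => f x + g x) = expect p f + expect p g.
Proof.
have [s us ps] := sd_supp p; rewrite /expect.
rewrite !(fsumTE us); try by move=> x /ps ->; rewrite mul0r.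
by rewrite -big_split; apply: eq_bigr => x _; rewrite mulrDr.
Qed.

Lemma expect_sum X (I : finType) (p : subdist X) (f : I -> X -> R) :
  expect p (fun x => \sum_i f i x) = \sum_i expect p (f i).
Proof.
have [s us ps] := sd_supp p; rewrite /expect.
rewrite (fsumTE us); last by move=> x /ps ->; rewrite mul0r.
under eq_bigr do rewrite mulr_sumr.
rewrite exchange_big; apply: eq_bigr => i _.
by rewrite (fsumTE us) // => x /ps ->; rewrite mul0r.
Qed.

Lemma fsumT_fin (I : finType) (g : I -> R) : fsumT g = \sum_i g i.
Proof.
pose s : seq {classic I} := map (id : I -> {classic I}) (enum I).
rewrite (@fsumTE _ s); first by rewrite big_map big_enum.
  by rewrite map_inj_uniq ?enum_uniq // => i j.
by move=> i; rewrite (map_f (id : I -> {classic I})) ?mem_enum.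
Qed.

Lemma sdmap_id X (p : subdist X) : sdmap id p = p.
Proof. by apply: expect_ext => g; rewrite expect_map. Qed.

Lemma sdmap_comp X Y Z (g : Y -> Z) (f : X -> Y) p :
  sdmap (g \o f) p = sdmap g (sdmap f p).
Proof. by apply: expect_ext => h; rewrite !expect_map. Qed.

Lemma sdmap_unit X Y (f : X -> Y) x : sdmap f (sdunit x) = sdunit (f x).
Proof. by apply: expect_ext => g; rewrite expect_map !expect_unit. Qed.

Lemma sdmap_mul X Y (f : X -> Y) P :
  sdmap f (sdmul P) = sdmul (sdmap (sdmap f) P).
Proof.
apply: expect_ext => g; rewrite expect_map !expect_mul expect_map.
by congr expect; apply: funext => p /=; rewrite expect_map.
Qed.

Lemma sdmul_unit X (p : subdist X) : sdmul (sdunit p) = p.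
Proof. by apply: expect_ext => g; rewrite expect_mul expect_unit. Qed.

Lemma sdmul_mapunit X (p : subdist X) : sdmul (sdmap (@sdunit X) p) = p.
Proof.
apply: expect_ext => g; rewrite expect_mul expect_map; congr expect.
by apply: funext => x /=; rewrite expect_unit.
Qed.

Lemma sdmul_mul X (P : subdist (subdist (subdist X))) :
  sdmul (sdmul P) = sdmul (sdmap (@sdmul X) P).
Proof.
apply: expect_ext => g; rewrite !expect_mul expect_map.
by congr expect; apply: funext => p /=; rewrite expect_mul.
Qed.

(* Positively convex algebras: Eilenberg-Moore algebras of the monad
   ([subdist], [sdunit], [sdmul]). *)
Record pca := Pca {
  pca_car :> Type ;
  pca_op : subdist pca_car -> pca_car ;
  pca_unit : forall x, pca_op (sdunit x) = x ;
  pca_mul : forall P, pca_op (sdmul P) = pca_op (sdmap pca_op P) }.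

Record hom (X Y : pca) := Hom {
  hom_fun :> X -> Y ;
  homP : forall p, hom_fun (pca_op p) = pca_op (sdmap hom_fun p) }.

Lemma hom_ext X Y (f g : hom X Y) : (forall x, f x = g x) -> f = g.
Proof.
case: f g => [f fP] [g gP] /= /funext fg; subst g.
by congr Hom; apply: Prop_irrelevance.
Qed.

Definition hom_id (X : pca) : hom X X.
Proof. by exists id => p; rewrite sdmap_id. Defined.

Definition hom_comp (X Y Z : pca) (g : hom Y Z) (f : hom X Y) : hom X Z.
Proof. by exists (g \o f) => p /=; rewrite !homP -sdmap_comp. Defined.

Definition free_pca (B : Type) : pca :=
  Pca (@sdmul_unit B) (@sdmul_mul B).

Definition free_fg (X : pca) : Prop :=
  exists (B : finType) (f : hom (free_pca B) X), bijective f.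

Record endofunctor := Endofunctor {
  fobj :> pca -> pca ;
  fmap : forall X Y, hom X Y -> hom (fobj X) (fobj Y) ;
  fmap_id : forall X, fmap (hom_id X) = hom_id (fobj X) ;
  fmap_comp : forall X Y Z (g : hom Y Z) (f : hom X Y),
    fmap (hom_comp g f) = hom_comp (fmap g) (fmap f) }.

Section Coalgebras.
Variable F : endofunctor.

Record coalgebra := Coalgebra {
  carrier :> pca ;
  out : hom carrier (F carrier) }.

Record coalg_hom (X Y : coalgebra) := CoalgHom {
  coalg_hom_fun :> hom X Y ;
  coalg_homP : forall x, fmap F coalg_hom_fun (out X x) = out Y (coalg_hom_fun x) }.

Definition beh_equiv (X Y : coalgebra) (x : X) (y : Y) : Prop :=
  exists (Z : coalgebra) (f : coalg_hom X Z) (g : coalg_hom Y Z), f x = g y.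

(* [zigzag Q x y]: for some n >= 1 there is a zig-zag
     X = Z_0 -> Z_1 <- Z_2 -> ... <- Z_2n = Y
   relating x and y whose nodes Z_0, ..., Z_2n all satisfy [Q]. *)
Inductive zigzag (Q : coalgebra -> Prop) :
    forall X Y : coalgebra, X -> Y -> Prop :=
| Zigzag1 (X Z Y : coalgebra) (f : coalg_hom X Z) (g : coalg_hom Y Z) (x : X) (y : Y) :
    Q X -> Q Z -> Q Y -> f x = g y -> zigzag Q x y
| ZigzagS (X Z1 Z2 Y : coalgebra) (f : coalg_hom X Z1) (g : coalg_hom Z2 Z1)
    (x : X) (z : Z2) (y : Y) :
    Q X -> Q Z1 -> f x = g z -> zigzag Q z y -> zigzag Q x y.

Definition proper_functor : Prop :=
  forall (B1 B2 : finType) (c1 : hom (free_pca B1) (F (free_pca B1)))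
    (c2 : hom (free_pca B2) (F (free_pca B2))) (b1 : B1) (b2 : B2),
  @beh_equiv (Coalgebra c1) (Coalgebra c2) (sdunit b1) (sdunit b2) ->
  @zigzag free_fg (Coalgebra c1) (Coalgebra c2)
    (sdunit b1) (sdunit b2).

End Coalgebras.

Section Fhat.
Variable A : finType.

(* In a positively convex algebra, \sum_j p_j x_j for p_1, ..., p_n >= 0 with
   \sum_j p_j <= 1 is the value of the structure map at \sum_j p_j delta_(x_j),
   that is, at the image of p : subdist 'I_n under j |-> x_j. *)
Definition pcomb (X : pca) n (p : subdist 'I_n) (x : 'I_n -> X) : X :=
  pca_op (sdmap x p).

Definition in_Fhat (X : pca) (o : R) (phi : A -> X) : Prop :=
  exists (n : A -> nat) (p : forall a, subdist 'I_(n a))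
      (x : forall a, 'I_(n a) -> X),
    o + \sum_a \sum_(j < n a) p a j <= 1 /\
    forall a, phi a = pcomb (p a) (x a).

Record Fhat_car (X : pca) := FhatCar {
  Fhat_o : R ;
  Fhat_phi : A -> X ;
  Fhat_o01 : 0 <= Fhat_o <= 1 ;
  Fhat_in : in_Fhat Fhat_o Fhat_phi }.

Lemma Fhat_ext X (u v : Fhat_car X) :
  Fhat_o u = Fhat_o v -> (forall a, Fhat_phi u a = Fhat_phi v a) -> u = v.
Proof.
case: u v => [o phi o01 i] [o' phi' o01' i'] /= oo /funext pp; subst o' phi'.
by congr FhatCar; apply: Prop_irrelevance.
Qed.

Lemma in_FhatP (X : pca) o (phi : A -> X) : in_Fhat o phi <->
  exists p : A -> subdist X,
    o + \sum_a fsumT (p a) <= 1 /\ forall a, phi a = pca_op (p a).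
Proof.
split=> [[n [p [x [le1 phiE]]]]|[p [le1 phiE]]].
  exists (fun a => sdmap (x a) (p a)); split=> [|a]; last exact: phiE.
  congr (_ + _ <= 1): le1; apply: eq_bigr => a _.
  by rewrite -[RHS]expect1 expect_map -fsumT_fin -expect1.
have {phiE}phiE' a : exists m : {n & (subdist 'I_n * ('I_n -> X))%type},
    fsumT (projT2 m).1 = fsumT (p a) /\ phi a = pcomb (projT2 m).1 (projT2 m).2.
  have [s us ps] := sd_supp (p a).
  pose x (i : 'I_(size s)) : X := tnth (in_tuple s) i.
  pose q (i : 'I_(size s)) : R := p a (x i).
  have sumE (g : X -> R) : fsumT (fun i => q i * g (x i)) = expect (p a) g.
    rewrite /expect (fsumTE us); last by move=> y /ps ->; rewrite mul0r.
    by rewrite fsumT_fin [RHS]big_tnth.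
  have q0 i : 0 <= q i by exact: sd_ge0.
  have qf : finite_set [set i | q i <> 0]%classic by exact: finite_finset.
  have qt : fsumT q = fsumT (p a).
    rewrite -[RHS]expect1 -sumE; congr fsumT.
    by apply: funext => i; rewrite mulr1.
  have q1 : fsumT q <= 1 by rewrite qt sd_le1.
  exists (existT _ (size s) (Subdist q0 qf q1, x)) => /=; split => //.
  rewrite phiE /pcomb; congr pca_op; apply: expect_ext => g.
  by rewrite expect_map -sumE.
pose m a := projT1 (cid (phiE' a)).
exists (fun a => projT1 (m a)), (fun a => (projT2 (m a)).1).
exists (fun a => (projT2 (m a)).2); split=> [|a].
  congr (_ + _ <= 1): le1; apply: eq_bigr => a _; rewrite -fsumT_fin.
  by rewrite /m; case: cid => /= ? [].
by rewrite /m; case: cid => /= ? [].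
Qed.

(* The algebra structure is coordinatewise, as in the product [0,1] * X^A, where
   [0,1] carries the structure P |-> expected value of P. *)
Section Structure.
Variables (X : pca) (P : subdist (Fhat_car X)).

Let o : R := expect P (@Fhat_o X).

Let phi (a : A) : X := pca_op (sdmap (fun u => Fhat_phi u a) P).

Let o01 : 0 <= o <= 1.
Proof.
apply/andP; split.
  have -> : 0 = expect P (fun=> 0).
    by rewrite /expect /fsumT fsbig1 // => u _; rewrite mulr0.
  by apply: le_expect => u; case/andP: (Fhat_o01 u).
apply: le_trans (sd_le1 P); rewrite -expect1.
by apply: le_expect => u; case/andP: (Fhat_o01 u).
Qed.

Let oin : in_Fhat o phi.
Proof.
pose m (u : Fhat_car X) := projT1 (cid ((in_FhatP _ _).1 (Fhat_in u))).
have m1 u : Fhat_o u + \sum_a fsumT (m u a) <= 1.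
  by rewrite /m; case: cid => /= ? [].
have mE u a : Fhat_phi u a = pca_op (m u a).
  by rewrite /m; case: cid => /= ? [].
apply/in_FhatP; exists (fun a => sdmul (sdmap (m^~ a) P)); split=> [|a].
  have -> : \sum_a fsumT (sdmul (sdmap (m^~ a) P)) =
      expect P (fun u => \sum_a fsumT (m u a)).
    rewrite expect_sum; apply: eq_bigr => a _.
    rewrite -expect1 expect_mul expect_map; congr expect.
    by apply: funext => u /=; rewrite expect1.
  rewrite -expectD; apply: le_trans (sd_le1 P); rewrite -expect1.
  exact: le_expect.
rewrite pca_mul -sdmap_comp /phi; congr (pca_op (sdmap _ _)).
by apply: funext => u; rewrite mE.
Qed.

Definition Fhat_op : Fhat_car X := FhatCar o01 oin.

End Structure.

Lemma Fhat_op_unit (X : pca) (u : Fhat_car X) : Fhat_op (sdunit u) = u.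
Proof.
apply: Fhat_ext => [|a] /=; first by rewrite expect_unit.
by rewrite sdmap_unit pca_unit.
Qed.

Lemma Fhat_op_mul (X : pca) (P : subdist (subdist (Fhat_car X))) :
  Fhat_op (sdmul P) = Fhat_op (sdmap (@Fhat_op X) P).
Proof.
apply: Fhat_ext => [|a] /=; first by rewrite expect_mul expect_map.
by rewrite sdmap_mul pca_mul -!sdmap_comp.
Qed.

Definition Fhat_obj (X : pca) : pca :=
  Pca (@Fhat_op_unit X) (@Fhat_op_mul X).

Section Map.
Variables (X Y : pca) (f : hom X Y).

Lemma in_Fhat_map o (phi : A -> X) : in_Fhat o phi -> in_Fhat o (f \o phi).
Proof.
move=> [n [p [x [le1 phiE]]]]; exists n, p, (fun a => f \o x a); split=> // a.
by rewrite /= phiE /pcomb homP -sdmap_comp.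
Qed.

Definition Fhat_fun (u : Fhat_obj X) : Fhat_obj Y :=
  FhatCar (Fhat_o01 u) (in_Fhat_map (Fhat_in u)).

Lemma Fhat_funP p : Fhat_fun (pca_op p) = pca_op (sdmap Fhat_fun p).
Proof.
apply: Fhat_ext => [|a] /=; first by rewrite expect_map.
by rewrite homP -!sdmap_comp.
Qed.

Definition Fhat_map : hom (Fhat_obj X) (Fhat_obj Y) := Hom Fhat_funP.

End Map.

Lemma Fhat_map_id X : Fhat_map (hom_id X) = hom_id (Fhat_obj X).
Proof. by apply: hom_ext => u; apply: Fhat_ext. Qed.

Lemma Fhat_map_comp X Y Z (g : hom Y Z) (f : hom X Y) :
  Fhat_map (hom_comp g f) = hom_comp (Fhat_map g) (Fhat_map f).
Proof. by apply: hom_ext => u; apply: Fhat_ext. Qed.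

Definition Fhat : endofunctor := Endofunctor Fhat_map_id Fhat_map_comp.

Section Trace.
Variable X : coalgebra Fhat.

Definition coalg_o (x : X) : R := Fhat_o (out X x).

Definition coalg_next (a : A) (x : X) : X := Fhat_phi (out X x) a.

(* [foldl] gives c_(wa) = c_a \o c_w, where wa is [rcons w a]. *)
Definition coalg_word (w : seq A) (x : X) : X :=
  foldl (fun y a => coalg_next a y) x w.

Definition coalg_trace (x : X) (w : seq A) : R := coalg_o (coalg_word w x).

End Trace.

End Fhat.

End Subdistributions.

(* Main.v *)
(* On a coalgebra with carrier [Delta^n], let [u_i] be the sum of the trace of the
   [i]-th generator over all words. Then [u = o + \sum_a u c_a], so the weight
   [u] of a point is determined by its trace, and the simplex
   [{xi >= 0 | u xi <= 1}] carries a coalgebra whose out-weight is exactly the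
   weight. These rescaled simplices are the outer nodes of the zig-zag. The pairs
   of nonnegative vectors with the same trace form a cone, the intersection of a
   linear subspace with an orthant, hence a finitely generated one. Both
   coordinates of such a pair have the same weight, so the free algebra on the
   generators of the cone carries a lifted coalgebra structure: it is the middle
   node, the legs of the span being the two coordinate projections. *)
Require Import Defs.
From mathcomp Require Import all_boot all_order all_algebra reals.
From mathcomp Require Import boolp classical_sets cardinality sequences topology normedtype.
From mathcomp Require Import ring.
Set Implicit Arguments.
Unset Strict Implicit.
Unset Printing Implicit Defensive.
Import Order.TTheory GRing.Theory Num.Theory.
Import numFieldNormedType.Exports.
Import Defs.
Local Open Scope ring_scope.

(** * Finite generation of the nonnegative part of a linear subspace *)

Section Cone.
Variables (R : realType) (I : finType) (P : (I -> R) -> Prop).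
Hypothesis P0 : P (fun=> 0).
Hypothesis PB : forall f g t, P f -> P g -> P (fun i => f i - t * g i).

(** One generator per support suffices: [g S] is chosen nonzero and vanishing outside [S] whenever
    the cone contains such a vector. Induction on the size of the support of [f] then yields the
    coefficients. *)
Lemma cone_generators : exists g : {set I} -> I -> R,
  [/\ forall S, P (g S), forall S i, 0 <= g S i &
      forall f, P f -> (forall i, 0 <= f i) ->
        exists2 l : {set I} -> R, forall S, 0 <= l S &
          forall i, f i = \sum_S l S * g S i].
Proof.
pose good (S : {set I}) (g : I -> R) := [/\ P g, forall i, 0 <= g i &
  (forall i, i \notin S -> g i = 0) /\
  ((exists f, [/\ P f, forall i, 0 <= f i, forall i, i \notin S -> f i = 0 &
      exists i, f i != 0]) -> exists i, g i != 0)].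
have /choice[g gP] S : exists g, good S g.
  have [[f [fP f0 fS fn]]|nf] := pselect (exists f, [/\ P f, forall i, 0 <= f i,
      forall i, i \notin S -> f i = 0 & exists i, f i != 0]).
    by exists f; split.
  by exists (fun=> 0); split.
exists g; split=> [S|S i|f]; [by case: (gP S) | by case: (gP S) |].
(* Subtracting the largest admissible multiple of a vector supported in the
   support of [f] shrinks that support. *)
have [n] := ubnP #|[set i | f i != 0]|.
elim: n f => // n IHn f; rewrite ltnS => fn Pf f0.
set S := [set i | f i != 0] in fn.
have fS i : i \notin S -> f i = 0 by rewrite inE negbK => /eqP.
have [Se|[i0 i0S]] := set_0Vmem S.
  exists (fun=> 0) => // i; rewrite big1 => [|T _]; last by rewrite mul0r.
  by apply: fS; rewrite Se inE.
have [Pg g0 [gS gn]] := gP S.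
have [k0 gk0] : exists i, g S i != 0.
  by apply: gn; exists f; split=> //; exists i0; rewrite inE in i0S.
(* The least ratio over the support of [g S] is the largest multiple that keeps the difference
   nonnegative; the index attaining it leaves the support. *)
have [k gk kmin] := @arg_minP _ _ _ k0 (fun i => g S i != 0)
  (fun i => f i / g S i) gk0.
set t := f k / g S k in kmin.
have t0 : 0 <= t by rewrite divr_ge0.
have gpos i : g S i != 0 -> 0 < g S i by move=> gi; rewrite lt0r gi g0.
pose f' i := f i - t * g S i.
have f'0 i : 0 <= f' i.
  rewrite /f' subr_ge0; have [->|/[dup] gi /gpos gi0] := eqVneq (g S i) 0.
    by rewrite mulr0.
  by rewrite -ler_pdivlMr // kmin.
have f'S : [set i | f' i != 0] \proper S.
  apply/fintype.properP; split.
    apply/fintype.subsetP => i; rewrite inE; apply: contraR => iS.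
    by rewrite /f' (fS i iS) (gS i iS) mulr0 subrr.
  exists k; last by rewrite inE negbK /f' /t divfK ?subrr.
  by apply: contraR gk => /gS ->.
have [|l l0 lE] := IHn f' _ (PB t Pf Pg) f'0.
  exact: leq_trans (proper_card f'S) fn.
exists (fun T => l T + t *+ (T == S)) => [T|i].
  by rewrite addr_ge0 ?mulrn_wge0.
under eq_bigr do rewrite mulrDl.
rewrite big_split /= -lE (bigD1 S) //= eqxx big1 ?addr0 ?subrK // => T /negPf ->.
by rewrite mulr0n mul0r.
Qed.

End Cone.

(** * Free algebras: extension from generators, and membership in [Fhat] *)

Section Free.
Variable R : realType.

Lemma expect_fin (I : finType) (p : subdist R I) (g : I -> R) :
  expect p g = \sum_i p i * g i.
Proof. by rewrite /expect fsumT_fin. Qed.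

Lemma subdist_of_fun (I : finType) (f : I -> R) : (forall i, 0 <= f i) ->
  \sum_i f i <= 1 -> exists p : subdist R I, forall i, p i = f i.
Proof.
move=> f0 f1.
have ff : finite_set [set i | f i <> 0]%classic.
  apply: (@finite_suppI R I [seq (i : {classic I}) | i <- enum I]) => i /negP[].
  by apply: (map_f (id : I -> {classic I})); rewrite mem_enum.
have f1' : fsumT f <= 1 by rewrite fsumT_fin.
by exists (Subdist f0 ff f1').
Qed.

Section Extension.
Variables (B : Type) (X : pca R) (k : B -> X).

Lemma extendP (p : subdist R (free_pca R B)) :
  pca_op (sdmap k (sdmul p)) = pca_op (sdmap (fun q => pca_op (sdmap k q)) p).
Proof. by rewrite sdmap_mul pca_mul -sdmap_comp. Qed.

Definition extend : hom (free_pca R B) X :=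
  @Hom R (free_pca R B) X (fun p => pca_op (sdmap k p)) extendP.

Lemma extend_unit b : extend (sdunit R b) = k b.
Proof. by rewrite /= sdmap_unit pca_unit. Qed.

End Extension.

Lemma free_hom_eq (B : Type) (X : pca R) (f g : hom (free_pca R B) X) :
  (forall b, f (sdunit R b) = g (sdunit R b)) -> forall p, f p = g p.
Proof.
move=> fg p; rewrite -(sdmul_mapunit p).
rewrite (homP f (sdmap _ _)) (homP g (sdmap _ _)) -!sdmap_comp.
by congr (pca_op (sdmap _ _)); apply: funext => b; exact: fg.
Qed.

Lemma extendE (B : finType) (K : Type) (k : B -> free_pca R K) p j :
  extend k p j = \sum_b p b * k b j.
Proof.
rewrite -expect_fin.
exact: (expect_map k p (fun q : subdist R K => q j)).
Qed.

Lemma fsumT_sdmul (X : Type) (P : subdist R (subdist R X)) :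
  fsumT (sdmul P) <= fsumT P.
Proof.
rewrite -!expect1 expect_mul; apply: le_expect => p.
by rewrite expect1; exact: sd_le1.
Qed.

Lemma fsumT_sdmap (X Y : Type) (f : X -> Y) (p : subdist R X) :
  fsumT (sdmap f p) = fsumT p.
Proof. by rewrite -!expect1 expect_map. Qed.

(** Flattening a representation of [phi a] cannot increase its mass, and the representation by Dirac
    points attains the mass of [phi a]; the existential in [in_Fhat] thus becomes an inequality. *)
Lemma in_Fhat_free (A : finType) (B : Type) o (phi : A -> free_pca R B) :
  in_Fhat o phi <-> o + \sum_a fsumT (phi a) <= 1.
Proof.
split=> [/in_FhatP[p [le1 phiE]]|le1].
  apply: le_trans le1; rewrite lerD2l; apply: ler_sum => a _.
  by rewrite phiE; exact: fsumT_sdmul.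
apply/in_FhatP; exists (fun a => sdmap (@sdunit R B) (phi a)); split=> [|a].
  by under eq_bigr do rewrite fsumT_sdmap.
by rewrite /= sdmul_mapunit.
Qed.

End Free.

(** * Coalgebra morphisms and the invariance of traces *)

Section Coalgebras.
Variables (R : realType) (F : endofunctor R).

Lemma coalg_comp (X Y Z : coalgebra F) (g : coalg_hom Y Z) (f : coalg_hom X Y) :
  exists h : coalg_hom X Z, forall x, h x = g (f x).
Proof.
have hP x : fmap F (hom_comp g f) (out X x) = out Z (hom_comp g f x).
  by rewrite fmap_comp /= !coalg_homP.
by exists (CoalgHom hP).
Qed.

End Coalgebras.

Section Trace.
Variables (R : realType) (A : finType).

Lemma coalg_trace_hom (X Y : coalgebra (Fhat R A)) (f : coalg_hom X Y) x :
  coalg_trace (f x) =1 coalg_trace x.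
Proof.
have oE z : coalg_o (f z) = coalg_o z by rewrite /coalg_o -coalg_homP.
have nE a z : coalg_next a (f z) = f (coalg_next a z).
  by rewrite /coalg_next -coalg_homP.
move=> w; rewrite /coalg_trace; elim: w x => [|a w IHw] x; first exact: oE.
by rewrite /= nE; exact: IHw.
Qed.

End Trace.

(** * Weighted systems and their rescaled simplices *)

Section System.
Variables (R : realType) (A : finType).

(* A subinvariant weight makes the rescaled simplex
   [{xi >= 0 | \sum_i xi i * weight i <= 1}] carry a coalgebra structure. *)
Record system (I : finType) := System {
  output : I -> R ;
  trans : A -> I -> I -> R ;
  weight : I -> R ;
  output_ge0 : forall i, 0 <= output i ;
  trans_ge0 : forall a i j, 0 <= trans a i j ;
  weight_ge0 : forall i, 0 <= weight i ;
  weight_subinv : forall i,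
    output i + \sum_a \sum_j trans a i j * weight j <= weight i }.

Section Rescale.
Variables (I : finType) (W : system I).

Lemma divr_le1 (x u : R) : x <= u -> 0 <= u -> x / u <= 1.
Proof.
rewrite le0r => xu /predU1P[->|u0]; first by rewrite invr0 mulr0.
by rewrite ler_pdivrMr // mul1r.
Qed.

(** Conjugating the transition matrices by the diagonal of weights turns subinvariance into the
    bound required by [in_Fhat]. *)
Lemma rescale_subproof i : exists v : Fhat_car A (free_pca R I),
  Fhat_o v = output W i / weight W i /\
  forall a (j : I), Fhat_phi v a j = trans W a i j * weight W j / weight W i.
Proof.
have [[o0 M0] u0] := (output_ge0 W, trans_ge0 W, weight_ge0 W).
have s0 b j : 0 <= trans W b i j * weight W j by rewrite mulr_ge0.
have uo : output W i <= weight W i.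
  apply: le_trans (weight_subinv W i); rewrite lerDl.
  by do 2![apply: sumr_ge0 => ? _].
have uM a : \sum_j trans W a i j * weight W j <= weight W i.
  apply: le_trans (weight_subinv W i); rewrite (bigD1 a) //= addrCA lerDl.
  by rewrite addr_ge0 //; do 2![apply: sumr_ge0 => ? _].
have /choice[phi phiE] a : exists p : subdist R I,
    forall j, p j = trans W a i j * weight W j / weight W i.
  apply: subdist_of_fun => [j|]; first by rewrite divr_ge0.
  by rewrite -mulr_suml divr_le1.
have o01 : 0 <= output W i / weight W i <= 1 by rewrite divr_ge0 ?divr_le1.
have oin : @in_Fhat R A (free_pca R I) (output W i / weight W i) phi.
  apply/in_Fhat_free.
  under eq_bigr => a _.
    rewrite fsumT_fin; under eq_bigr do rewrite phiE.
    rewrite -mulr_suml.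
  over.
  by rewrite /= -mulr_suml -mulrDl divr_le1 // weight_subinv.
by exists (FhatCar o01 oin); split=> //= a j; rewrite phiE.
Qed.

(* Coordinates are rescaled so that the simplex becomes the standard one; where
   the weight is 0, [x / 0 = 0] makes the generator move to 0. *)
Definition rescale_out i := projT1 (cid (rescale_subproof i)).

Definition rescale : coalgebra (Fhat R A) :=
  @Coalgebra R (Fhat R A) (free_pca R I)
    (@extend R I (Fhat_obj A (free_pca R I)) rescale_out).

Lemma rescale_o (p : rescale) :
  Fhat_o (out rescale p) = \sum_i p i * (output W i / weight W i).
Proof.
rewrite /= expect_map expect_fin; apply: eq_bigr => i _; congr (_ * _).
by rewrite /= /rescale_out; case: cid => v [].
Qed.

Lemma rescale_phi (p : rescale) a (j : I) :
  (Fhat_phi (out rescale p) a : subdist R I) j =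
  \sum_i p i * (trans W a i j * weight W j / weight W i).
Proof.
rewrite [LHS](expect_map _ _ (fun q : subdist R I => q j)) expect_map.
rewrite expect_fin; apply: eq_bigr => i _; congr (_ * _).
by rewrite /= /rescale_out; case: cid => v [].
Qed.

End Rescale.

(** The hypotheses say that [T] intertwines the two systems and does not increase weight; conjugated
    by the weights it therefore maps simplex to simplex. *)
Lemma rescale_hom (I K : finType) (W : system I) (V : system K)
    (T : I -> K -> R) :
  (forall i k, 0 <= T i k) ->
  (forall i, \sum_k T i k * weight V k <= weight W i) ->
  (forall i, \sum_k T i k * output V k = output W i) ->
  (forall a i k, \sum_j trans W a i j * T j k = \sum_l T i l * trans V a l k) ->
  exists f : coalg_hom (rescale W) (rescale V), forall (p : rescale W) (k : K),
    (f p : subdist R K) k = \sum_i p i * (T i k * weight V k / weight W i).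
Proof.
move=> T0 TW To TM.
have [u0 v0] := (weight_ge0 W, weight_ge0 V).
have le0_eq0 (J : finType) (h : J -> R) : (forall j, 0 <= h j) ->
    \sum_j h j <= 0 -> forall j, h j = 0.
  move=> h0 hs j; apply/eqP; rewrite eq_le h0 andbT; apply: le_trans hs.
  by rewrite (bigD1 j) //= lerDl sumr_ge0.
(* This and the next two identities cancel a weight that may be 0: the bounds [TW] and
   [weight_subinv] then force the numerator to be 0 as well. *)
have uT i k : T i k * weight V k / weight W i * weight W i = T i k * weight V k.
  have [ui|ui] := eqVneq (weight W i) 0; last by rewrite divfK.
  rewrite ui mulr0; have := TW i; rewrite ui => /le0_eq0 -> // j.
  exact: mulr_ge0.
have vo k : output V k / weight V k * weight V k = output V k.
  have [vk|vk] := eqVneq (weight V k) 0; last by rewrite divfK.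
  rewrite vk mulr0; apply/eqP; rewrite eq_le output_ge0 /=.
  have := weight_subinv V k; rewrite vk; apply: le_trans; rewrite lerDl.
  by do 2![apply: sumr_ge0 => ? _]; rewrite mulr_ge0 ?trans_ge0.
have vM a l k : trans V a l k * weight V k / weight V l * weight V l =
    trans V a l k * weight V k.
  have [vl|vl] := eqVneq (weight V l) 0; last by rewrite divfK.
  have M0 b j : 0 <= trans V b l j * weight V j by rewrite mulr_ge0 ?trans_ge0.
  rewrite vl mulr0; apply/esym.
  apply: (le0_eq0 _ (fun j => trans V a l j * weight V j)) => //.
  have := weight_subinv V l; rewrite vl; apply: le_trans.
  rewrite (bigD1 a) //= addrCA lerDl addr_ge0 ?output_ge0 //.
  by do 2![apply: sumr_ge0 => ? _].
have /choice[t tE] i : exists p : subdist R K,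
    forall k, p k = T i k * weight V k / weight W i.
  apply: subdist_of_fun => [k|]; first by rewrite divr_ge0 ?mulr_ge0.
  by rewrite -mulr_suml divr_le1.
pose h : hom (rescale W) (rescale V) := @extend R I (free_pca R K) t.
have hP p : fmap (Fhat R A) h (out (rescale W) p) = out (rescale V) (h p).
  move: p; apply: (@free_hom_eq R I _ (hom_comp (fmap (Fhat R A) h) _)
    (hom_comp (out (rescale V)) h)) => i.
  have hE k : (h (sdunit R i) : subdist R K) k = T i k * weight V k / weight W i.
    by rewrite -tE /h extend_unit.
  have unitE (g : I -> R) : \sum_j (sdunit R i) j * g j = g i.
    by rewrite -[RHS](expect_unit i) expect_fin.
  apply: Fhat_ext => [|a].
    rewrite [LHS](rescale_o (W := W)) [RHS](rescale_o (W := V)) unitE.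
    rewrite -To mulr_suml; apply: eq_bigr => k _; rewrite hE -{1}[output V k]vo.
    by ring.
  apply: sd_ext => k.
  rewrite [RHS](rescale_phi (W := V)).
  rewrite [LHS]extendE.
  (* The intermediate weight [weight W j] cancels, which leaves the unscaled matrix product to which
     [TM] applies. *)
  transitivity (\sum_j (trans W a i j * weight W j / weight W i) *
      (T j k * weight V k / weight W j)).
    apply: eq_bigr => j _; rewrite tE; congr (_ * _).
    by rewrite (rescale_phi (W := W)) unitE.
  transitivity (\sum_j trans W a i j * T j k * (weight V k / weight W i)).
    apply: eq_bigr => j _.
    transitivity (trans W a i j * (T j k * weight V k) / weight W i).
      by rewrite -[in RHS]uT; ring.
    by ring.
  rewrite -mulr_suml TM mulr_suml; apply: eq_bigr => l _.
  rewrite hE; transitivity (T i l * (trans V a l k * weight V k) / weight W i).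
    by ring.
  by rewrite -[in LHS]vM; ring.
exists (CoalgHom hP) => p k.
by rewrite [LHS]extendE; apply: eq_bigr => i _; rewrite tE.
Qed.

Lemma eq_ler (x y : R) : x = y -> x <= y.
Proof. by move=> ->. Qed.

(** * Traces of vectors and the total weight *)

Section Total.
Variables (I : finType) (W : system I).

Definition step (a : A) (xi : I -> R) (j : I) : R :=
  \sum_i xi i * trans W a i j.

(** Defined on all real vectors, so that having equal traces is a linear condition on pairs. *)
Fixpoint system_trace (xi : I -> R) (w : seq A) : R :=
  if w is a :: w' then system_trace (step a xi) w'
  else \sum_i xi i * output W i.

Lemma system_traceB xi eta t w :
  system_trace (fun i => xi i - t * eta i) w =
  system_trace xi w - t * system_trace eta w.
Proof.
elim: w xi eta => [|a w IHw] xi eta /=.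
  by rewrite mulr_sumr -sumrB; apply: eq_bigr => i _; ring.
rewrite -IHw; congr system_trace; apply: funext => j; rewrite /step.
by rewrite mulr_sumr -sumrB; apply: eq_bigr => i _; ring.
Qed.

(** Transposition: pushing the row vector [xi] forward is adjoint to pulling the column [v] back.
    This matches the recursion of [mass] with that of the trace. *)
Lemma step_dual xi v :
  \sum_i xi i * (output W i + \sum_a \sum_j trans W a i j * v j) =
  \sum_i xi i * output W i + \sum_a \sum_j step a xi j * v j.
Proof.
under eq_bigr do rewrite mulrDr mulr_sumr.
rewrite big_split exchange_big; congr (_ + _); apply: eq_bigr => a _.
under eq_bigr do rewrite mulr_sumr.
rewrite exchange_big; apply: eq_bigr => j _.
by rewrite /step mulr_suml; apply: eq_bigr => i _; rewrite mulrA.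
Qed.

(* [mass n i] sums the trace of the generator [i] over words of length < n. *)
Fixpoint mass (n : nat) (i : I) : R :=
  if n is n'.+1 then output W i + \sum_a \sum_j trans W a i j * mass n' j else 0.

Lemma mass_ge0 n i : 0 <= mass n i.
Proof.
elim: n i => //= n IHn i; rewrite addr_ge0 ?output_ge0 //.
by do 2![apply: sumr_ge0 => ? _]; rewrite mulr_ge0 ?trans_ge0.
Qed.

Lemma mass_le n i : mass n i <= weight W i.
Proof.
elim: n i => /= [|n IHn] i; first exact: weight_ge0.
apply: le_trans (weight_subinv W i); rewrite lerD2l.
by do 2![apply: ler_sum => ? _]; rewrite ler_wpM2l ?trans_ge0.
Qed.

Lemma mass_leS n i : mass n i <= mass n.+1 i.
Proof.
elim: n i => [|n IHn] i; first exact: mass_ge0.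
rewrite /= lerD2l.
by do 2![apply: ler_sum => ? _]; rewrite ler_wpM2l ?trans_ge0.
Qed.

Lemma mass_cvg i : cvgn (mass ^~ i).
Proof.
apply: nondecreasing_is_cvgn; first by apply/nondecreasing_seqP => n; exact: mass_leS.
by exists (weight W i) => _ [n _ <-]; exact: mass_le.
Qed.

Definition total (i : I) : R := limn (mass ^~ i).

Lemma total_ge0 i : 0 <= total i.
Proof. by apply: limr_ge; [exact: mass_cvg | apply: nearW => n; exact: mass_ge0]. Qed.

Lemma total_le i : total i <= weight W i.
Proof. by apply: limr_le; [exact: mass_cvg | apply: nearW => n; exact: mass_le]. Qed.

Lemma cvg_dot_mass (xi : I -> R) :
  ((fun n => \sum_i xi i * mass n i) @ \oo --> \sum_i xi i * total i)%classic.
Proof.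
apply: cvg_big => [|i _]; first exact: add_continuous.
by apply: cvgMl_tmp; exact: mass_cvg.
Qed.

(** The recursion of [mass] passes to the limit, along the sequence shifted by one. *)
Lemma total_inv i :
  output W i + \sum_a \sum_j trans W a i j * total j = total i.
Proof.
apply/esym/cvg_lim => //; rewrite -cvg_shiftS /=.
apply: cvgD; first exact: cvg_cst.
apply: cvg_big => [|a _]; first exact: add_continuous.
exact: cvg_dot_mass.
Qed.

Definition total_system : system I :=
  System (output_ge0 W) (trans_ge0 W) total_ge0 (fun i => eq_ler (total_inv i)).

End Total.

(** Pairing a vector with [mass n] sums its trace over the words shorter than [n]; both sides are
    limits of such sums. *)
Lemma total_trace (I K : finType) (W : system I) (V : system K) xi eta :
  system_trace W xi =1 system_trace V eta ->
  \sum_i xi i * total W i = \sum_k eta k * total V k.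
Proof.
move=> xe; rewrite -(cvg_lim _ (@cvg_dot_mass I W xi)) //.
rewrite -(cvg_lim _ (@cvg_dot_mass K V eta)) //; apply: (congr1 (fun h : nat -> R => limn h)).
apply: funext => n; elim: n xi eta xe => [|n IHn] xi eta xe /=.
  by rewrite !big1 // => i _; rewrite mulr0.
rewrite !step_dual; move: (xe [::]) => /= ->; congr (_ + _); apply: eq_bigr => a _.
by apply: IHn => w; exact: (xe (a :: w)).
Qed.

(** * Systems presenting free coalgebras, and the span between equal traces *)

Lemma coalg_trace_rescale (I : finType) (W : system I) (p : rescale W) :
  (forall i, weight W i = 1) -> coalg_trace p =1 system_trace W (p : subdist R I).
Proof.
move=> W1 w; rewrite /coalg_trace; elim: w p => [|a w IHw] p.
  rewrite /coalg_o rescale_o; apply: eq_bigr => i _.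
  by rewrite W1 invr1 mulr1.
rewrite /= IHw; congr system_trace; apply: funext => j.
rewrite /coalg_next rescale_phi; apply: eq_bigr => i _.
by rewrite !W1 invr1 !mulr1.
Qed.

(** The structure is transported along the inverse of the isomorphism; the constant weight 1 is
    subinvariant by [in_Fhat_free]. *)
Lemma free_fg_rescale (X : coalgebra (Fhat R A)) : free_fg X ->
  exists (B : finType) (W : system B),
    (forall i, weight W i = 1) /\ inhabited (coalg_hom X (rescale W)).
Proof.
move=> [B [f [g fK gK]]].
have gP p : g (pca_op p) = pca_op (sdmap g p).
  rewrite -[RHS]fK homP -sdmap_comp; congr (g (pca_op _)).
  rewrite -[LHS]sdmap_id; congr sdmap; apply: funext => x.
  by rewrite /= gK.
pose h : hom X (free_pca R B) := @Hom R X (free_pca R B) g gP.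
pose v b : Fhat_obj A (free_pca R B) := Fhat_map A h (out X (f (sdunit R b))).
have o0 b : 0 <= Fhat_o (v b) by case/andP: (Fhat_o01 (v b)).
have M0 a b j : 0 <= (Fhat_phi (v b) a : subdist R B) j by exact: sd_ge0.
have W1 b : Fhat_o (v b) + \sum_a \sum_j (Fhat_phi (v b) a : subdist R B) j * 1 <= 1.
  have /in_Fhat_free := Fhat_in (v b); apply: le_trans; rewrite lerD2l.
  by apply: ler_sum => a _; rewrite fsumT_fin; under eq_bigr do rewrite mulr1.
pose W := System o0 M0 (fun=> ler01) W1.
exists B, W; split=> //.
suff hP x : fmap (Fhat R A) h (out X x) = out (rescale W) (h x).
  exact: inhabits (@CoalgHom R (Fhat R A) X (rescale W) h hP).
rewrite -(gK x); move: (g x) => p {x}.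
have -> : h (f p) = p by exact: fK.
move: p; apply: (@free_hom_eq R B _
  (hom_comp (fmap (Fhat R A) h) (hom_comp (out X) f)) (out (rescale W))) => b.
have unitE (k : B -> R) : \sum_j (sdunit R b) j * k j = k b.
  by rewrite -[RHS](expect_unit b) expect_fin.
apply: Fhat_ext => [|a].
  by rewrite [RHS](rescale_o (W := W)) unitE /= invr1 mulr1.
apply: sd_ext => j.
by rewrite [RHS](rescale_phi (W := W)) unitE /= invr1 !mulr1.
Qed.

Lemma free_fg_rescaled (I : finType) (W : system I) : free_fg (rescale W).
Proof. by exists I, (hom_id _), id. Qed.

(** This is the inclusion into a larger simplex: the identity matrix does not increase weight
    because [total W] is at most 1. The factor [total W k] comes from the change of coordinates. *)
Lemma rescale_total (I : finType) (W : system I) :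
  (forall i, weight W i = 1) ->
  exists f : coalg_hom (rescale W) (rescale (total_system W)),
    forall (p : rescale W) (k : I),
      (f p : subdist R I) k = (p : subdist R I) k * total W k.
Proof.
move=> W1.
have idE (g : I -> R) i : \sum_k (i == k)%:R * g k = g i.
  rewrite (bigD1 i) //= eqxx mul1r big1 ?addr0 // => k.
  by rewrite eq_sym => /negPf->; rewrite mul0r.
have idM a i k : \sum_j trans W a i j * (j == k)%:R =
    \sum_l (i == l)%:R * trans W a l k.
  rewrite idE -[RHS](idE (trans W a i)).
  by apply: eq_bigr => j _; rewrite mulrC eq_sym.
have [f fE] := @rescale_hom I I W (total_system W) (fun i k => (i == k)%:R)
  (fun i k => ler0n _ _) (fun i => le_trans (eq_ler (idE _ i)) (total_le W i))
  (idE _) idM.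
exists f => p k; rewrite fE (bigD1 k) //= eqxx W1 mul1r divr1 big1 ?addr0 // => i.
by move=> /negPf->; rewrite !mul0r mulr0.
Qed.

(** The pair of [x] and [y] lies in the cone of equal traces, and its coefficients over the
    generators give [z]. The factors [total] are those produced by [rescale_total]. *)
Lemma trace_span (I K : finType) (W : system I) (V : system K)
    (x : subdist R I) (y : subdist R K) :
  (forall i, weight W i = 1) -> system_trace W x =1 system_trace V y ->
  exists (J : finType) (U : system J)
      (f : coalg_hom (rescale U) (rescale (total_system W)))
      (g : coalg_hom (rescale U) (rescale (total_system V))) (z : rescale U),
    (forall i, (f z : subdist R I) i = x i * total W i) /\
    (forall k, (g z : subdist R K) k = y k * total V k).
Proof.
move=> W1 xy.
pose P (zeta : I + K -> R) :=
  system_trace W (zeta \o inl) =1 system_trace V (zeta \o inr).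
have PB f g t : P f -> P g -> P (fun i => f i - t * g i).
  by move=> Pf Pg w; rewrite [LHS]system_traceB [RHS]system_traceB Pf Pg.
have P0 : P (fun=> 0).
  have trace0 (L : finType) (U : system L) w : system_trace U (fun=> 0) w = 0.
    elim: w => [|a w IHw] /=; first by rewrite big1 // => i _; rewrite mul0r.
    rewrite -[RHS]IHw; congr system_trace; apply: funext => j.
    by rewrite /step big1 // => i _; rewrite mul0r.
  by move=> w; rewrite !trace0.
have [g [Pg g0 gen]] := cone_generators P0 PB.
(* Equal traces have equal totals, so this one weight serves both projections. *)
pose u S := \sum_i g S (inl i) * total W i.
have uE S : u S = \sum_k g S (inr k) * total V k by exact: total_trace (Pg S).
(* Moving both coordinates by the same letter stays in the cone; expanding the result over the
   generators gives the lifted transition matrix [M]. *)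
pose next a S (l : I + K) := match l with
  | inl i => step W a (g S \o inl) i | inr k => step V a (g S \o inr) k end.
have next0 a S l : 0 <= next a S l.
  by case: l => l; apply: sumr_ge0 => i _; rewrite mulr_ge0 ?trans_ge0 ?g0.
have nextP a S : P (next a S) by move=> w; exact: (Pg S (a :: w)).
have /choice[M MP] (aS : A * {set (I + K)%type}) :
    exists l : {set (I + K)%type} -> R, (forall T, 0 <= l T) /\
      forall i, next aS.1 aS.2 i = \sum_T l T * g T i.
  by have [l l0 lE] := gen _ (nextP aS.1 aS.2) (next0 aS.1 aS.2); exists l.
pose o S := \sum_i g S (inl i) * output W i.
have oE S : o S = \sum_k g S (inr k) * output V k by exact: (Pg S [::]).
have o0 S : 0 <= o S by apply: sumr_ge0 => i _; rewrite mulr_ge0 ?output_ge0.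
have u0 S : 0 <= u S by apply: sumr_ge0 => i _; rewrite mulr_ge0 ?total_ge0.
have M0 a S T : 0 <= M (a, S) T by exact: (MP (a, S)).1.
have ME a S l : next a S l = \sum_T M (a, S) T * g T l by exact: (MP (a, S)).2.
have uM S : o S + \sum_a \sum_T M (a, S) T * u T <= u S.
  apply: eq_ler; rewrite /u.
  under [RHS]eq_bigr do rewrite -total_inv.
  rewrite step_dual; congr (_ + _); apply: eq_bigr => a _.
  under eq_bigr do rewrite mulr_sumr.
  rewrite exchange_big; apply: eq_bigr => j _.
  rewrite -[step _ _ _ _]/(next a S (inl j)) ME mulr_suml.
  by apply: eq_bigr => T _; rewrite mulrA.
pose U := System o0 M0 u0 uM.
have [f fE] := @rescale_hom _ _ U (total_system W) (fun S i => g S (inl i))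
  (fun S i => g0 S (inl i)) (fun S => lexx _) (fun S => erefl)
  (fun a S i => esym (ME a S (inl i))).
have [h hE] := @rescale_hom _ _ U (total_system V) (fun S k => g S (inr k))
  (fun S k => g0 S (inr k)) (fun S => eq_ler (esym (uE S))) (fun S => esym (oE S))
  (fun a S k => esym (ME a S (inr k))).
pose xy' (l : I + K) := match l with inl i => x i | inr k => y k end.
have [|c c0 cE] := gen xy' xy; first by case=> l; exact: sd_ge0.
(* The factor [u S] passes to rescaled coordinates; the mass of [z] is then the total of [x], at
   most 1 because [W] has weight 1. *)
have [z zE] : exists z : subdist R {set (I + K)%type}, forall S, z S = c S * u S.
  apply: subdist_of_fun => [S|]; first by rewrite mulr_ge0.
  apply: le_trans (sd_le1 x); rewrite fsumT_fin.
  apply: (@le_trans _ _ (\sum_i x i * total W i)); last first.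
    apply: ler_sum => i _; rewrite ler_piMr ?sd_ge0 //.
    by rewrite -(W1 i) total_le.
  apply: eq_ler; under eq_bigr do rewrite mulr_sumr.
  rewrite exchange_big; apply: eq_bigr => i _ /=; rewrite (cE (inl i) : x i = _) mulr_suml.
  by apply: eq_bigr => S _; rewrite mulrA.
(* Where [u S = 0], the quotients in [fE] and [hE] default to 0; the terms to be matched vanish
   there too. *)
have u0g S : u S = 0 -> (forall i, g S (inl i) * total W i = 0) /\
    (forall k, g S (inr k) * total V k = 0).
  move=> uS; split=> [i|k].
    apply: (psumr_eq0P _ uS (i := i)) => // j _.
    by rewrite mulr_ge0 ?total_ge0.
  rewrite uE in uS; apply: (psumr_eq0P _ uS (i := k)) => // j _.
  by rewrite mulr_ge0 ?total_ge0.
exists {set (I + K)%type}, U, f, h, z; split=> [i|k].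
  rewrite fE (cE (inl i) : x i = _) mulr_suml; apply: eq_bigr => S _; rewrite zE /=.
  have [uS|uS] := eqVneq (u S) 0; last by field.
  by rewrite -!mulrA (u0g S uS).1 uS; ring.
rewrite hE (cE (inr k) : y k = _) mulr_suml; apply: eq_bigr => S _; rewrite zE /=.
have [uS|uS] := eqVneq (u S) 0; last by field.
by rewrite -!mulrA (u0g S uS).2 uS; ring.
Qed.

(** Each outer leg passes to a presenting system and then enlarges the simplex; its value at the
    given point has the coordinates reached by the span. *)
Lemma trace_zigzag (X Y : coalgebra (Fhat R A)) (x : X) (y : Y) :
    free_fg X -> free_fg Y -> coalg_trace x =1 coalg_trace y ->
    exists (Z1 Z2 Z3 : coalgebra (Fhat R A))
      (f1 : coalg_hom X Z1) (f2 : coalg_hom Z2 Z1)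
      (f3 : coalg_hom Z2 Z3) (f4 : coalg_hom Y Z3) (z2 : Z2),
      [/\ free_fg Z1, free_fg Z2, free_fg Z3, f2 z2 = f1 x & f4 y = f3 z2].
Proof.
move=> /free_fg_rescale[I [W [W1 [f]]]] /free_fg_rescale[K [V [V1 [g]]]] xy.
have [f' f'E] := rescale_total W1; have [g' g'E] := rescale_total V1.
have [|J [U [f2 [f3 [z [f2E f3E]]]]]] :=
    @trace_span I K W V (f x) (g y) W1.
  move=> w; rewrite -!coalg_trace_rescale //.
  by rewrite !coalg_trace_hom.
have [f1 f1E] := coalg_comp f' f; have [f4 f4E] := coalg_comp g' g.
exists (rescale (total_system W)), (rescale U), (rescale (total_system V)).
exists f1, f2, f3, f4, z; split; try exact: free_fg_rescaled.
  by rewrite f1E; apply: sd_ext => i; rewrite f2E f'E.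
by rewrite f4E; apply: sd_ext => k; rewrite f3E g'E.
Qed.

End System.

Theorem theorem20 (R : realType) (A : finType) :
  proper_functor (Fhat R A) /\
  forall (X Y : coalgebra (Fhat R A)) (x : X) (y : Y),
    free_fg X -> free_fg Y -> coalg_trace x =1 coalg_trace y ->
    exists (Z1 Z2 Z3 : coalgebra (Fhat R A))
      (f1 : coalg_hom X Z1) (f2 : coalg_hom Z2 Z1)
      (f3 : coalg_hom Z2 Z3) (f4 : coalg_hom Y Z3) (z2 : Z2),
      [/\ free_fg Z1, free_fg Z2, free_fg Z3, f2 z2 = f1 x & f4 y = f3 z2].
Proof.
split; last exact: trace_zigzag.
move=> B1 B2 c1 c2 b1 b2 [Z [f [g fg]]].
have free (B : finType) : free_fg (free_pca R B) by exists B, (hom_id _), id.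
have [|Z1 [Z2 [Z3 [f1 [f2 [f3 [f4 [z [F1 F2 F3 e1 e2]]]]]]]]] :=
    @trace_zigzag R A (Coalgebra c1) (Coalgebra c2) (sdunit R b1) (sdunit R b2)
      (free B1) (free B2).
  (* Both traces agree with that of the common image in [Z]. *)
  by move=> w; rewrite -(coalg_trace_hom f) fg coalg_trace_hom.
apply: (ZigzagS (free B1) F1 (esym e1)).
exact: (Zigzag1 F2 F3 (free B2) (esym e2)).
Qed.
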